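(* Let $E/F$ be an elliptic curve over a number field $F$, let $p$ be a prime, let $L/F$ be a finite extension of number fields with no intermediate fields (i.e. there is no field $M$ with $F\subsetneq M\subsetneq L$), and let $G=\operatorname{Gal}(\widehat{L}/F)$, where $\widehat{L}$ is the normal closure of $L$ over $F$. If $G$ is not isomorphic to a quotient of $\operatorname{Gal}(F(E[p])/F)$, then $E(L)[p]=E(F)[p]$.
   Context: $E[p]$ is the $p$-torsion subgroup of $E(\overline{F})$, and $F(E[p])$ is the field generated over $F$ by the coordinates of all points of $E[p]$. For a field $M\supseteq F$, $E(M)[p]$ denotes the group of points of $E(M)$ killed by $p$. *)

(* Defs.v *)
From HB Require Import structures.
From mathcomp Require Import all_boot all_order all_algebra all_field.
From mathcomp Require Import generic_quotient boolp classical_sets.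
From mathcomp Require Import ring.

Set Implicit Arguments.
Unset Strict Implicit.
Unset Printing Implicit Defensive.

Import GRing.Theory.
Local Open Scope ring_scope.

(** Discriminant of y^2 + a1 x y + a3 y = x^3 + a2 x^2 + a4 x + a6 *)

Definition weierstrass_disc (K : fieldType) (a1 a2 a3 a4 a6 : K) : K :=
  let b2 := a1 ^+ 2 + 4 * a2 in
  let b4 := 2 * a4 + a1 * a3 in
  let b6 := a3 ^+ 2 + 4 * a6 in
  let b8 := a1 ^+ 2 * a6 + 4 * a2 * a6 - a1 * a3 * a4 + a2 * a3 ^+ 2
            - a4 ^+ 2 in
  - b2 ^+ 2 * b8 - 8 * b4 ^+ 3 - 27 * b6 ^+ 2 + 9 * b2 * b4 * b6.

Record ell_curve (K : fieldType) := EllCurve {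
  ec_a1 : K; ec_a2 : K; ec_a3 : K; ec_a4 : K; ec_a6 : K;
  ec_disc_neq0 : weierstrass_disc ec_a1 ec_a2 ec_a3 ec_a4 ec_a6 != 0
}.

Section Points.
Variables (K : fieldType) (E : ell_curve K).
Local Notation a1 := (ec_a1 E).
Local Notation a2 := (ec_a2 E).
Local Notation a3 := (ec_a3 E).
Local Notation a4 := (ec_a4 E).
Local Notation a6 := (ec_a6 E).

(** [None] is the point at infinity. *)
Definition on_curve (P : option (K * K)) : bool :=
  if P is Some (x, y) then
    y ^+ 2 + a1 * x * y + a3 * y == x ^+ 3 + a2 * x ^+ 2 + a4 * x + a6
  else true.

Record ec_point := EcPoint {
  ec_coords :> option (K * K);
  ec_pointP : on_curve ec_coords
}.
HB.instance Definition _ := [isSub for ec_coords].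
HB.instance Definition _ := [Choice of ec_point by <:].

Definition ec_zero : ec_point := EcPoint (erefl : on_curve None).

(** The third intersection point of the curve with the line of slope [l]
    through [(x1, y1)] and a (possibly infinitely near) second point of
    abscissa [x2], reflected by [(x, y) |-> (x, - y - a1 x - a3)]. *)
Definition chord_tangent (l x1 y1 x2 : K) : K * K :=
  let x3 := l ^+ 2 + a1 * l - a2 - x1 - x2 in
  (x3, - (l * (x3 - x1) + y1) - a1 * x3 - a3).

Definition add_coords (P Q : option (K * K)) : option (K * K) :=
  match P, Q with
  | None, _ => Q
  | _, None => P
  | Some (x1, y1), Some (x2, y2) =>
    if x1 == x2 then
      if y1 + y2 + a1 * x2 + a3 == 0 then None
      else Some (chord_tangent
        ((3 * x1 ^+ 2 + 2 * a2 * x1 + a4 - a1 * y1) / (2 * y1 + a1 * x1 + a3))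
        x1 y1 x2)
    else Some (chord_tangent ((y2 - y1) / (x2 - x1)) x1 y1 x2)
  end.

Lemma chord_tangent_on_curve (l x1 y1 x2 : K) :
  on_curve (Some (x1, y1)) ->
  x2 ^+ 2 + x2 * x1 + x1 ^+ 2 + (a2 - l ^+ 2 - a1 * l) * (x2 + x1)
  + (a4 - 2 * l * (y1 - l * x1) - a1 * (y1 - l * x1) - a3 * l) = 0 ->
  on_curve (Some (chord_tangent l x1 y1 x2)).
Proof.
move=> /eqP e1 e2; apply/eqP/eqP; rewrite -subr_eq0; apply/eqP.
set x3 := l ^+ 2 + a1 * l - a2 - x1 - x2.
set g := (X in X = 0) in e2.
transitivity ((y1 ^+ 2 + a1 * x1 * y1 + a3 * y1)
   - (x1 ^+ 3 + a2 * x1 ^+ 2 + a4 * x1 + a6) - (x3 - x1) * g).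
  by rewrite /g /x3; ring.
by rewrite e1 e2 mulr0 subrr subr0.
Qed.

Lemma add_coords_on_curve (P Q : option (K * K)) :
  on_curve P -> on_curve Q -> on_curve (add_coords P Q).
Proof.
case: P => [[x1 y1]|//]; case: Q => [[x2 y2]|//] cP cQ /=.
have /eqP e1 := cP; have /eqP e2 := cQ.
case: (eqVneq x1 x2) => [ex|nx].
  subst x2; case: (eqVneq (y1 + y2 + a1 * x1 + a3) 0) => // nz.
  have ey : y1 = y2.
    apply/eqP; rewrite -subr_eq0; apply/eqP/(mulIf nz); rewrite mul0r.
    transitivity ((y1 ^+ 2 + a1 * x1 * y1 + a3 * y1)
      - (y2 ^+ 2 + a1 * x1 * y2 + a3 * y2)); first by ring.
    by rewrite e1 e2 subrr.
  subst y2; have nz' : 2 * y1 + a1 * x1 + a3 != 0.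
    by apply: contra_neq nz => <-; ring.
  apply: chord_tangent_on_curve => //.
  set n := 3 * _ + _ + _ - _; set d := 2 * y1 + a1 * x1 + a3 in nz' *.
  transitivity (n - n / d * d); first by rewrite /n /d; ring.
  by rewrite divfK // subrr.
apply: chord_tangent_on_curve => //.
have nz : x2 - x1 != 0 by rewrite subr_eq0 eq_sym.
apply: (mulIf nz); rewrite mul0r.
set l := _ / _; have el : y2 = y1 + l * (x2 - x1).
  by rewrite /l divfK // addrC subrK.
transitivity ((y1 ^+ 2 + a1 * x1 * y1 + a3 * y1)
  - (x1 ^+ 3 + a2 * x1 ^+ 2 + a4 * x1 + a6)
  - ((y2 ^+ 2 + a1 * x2 * y2 + a3 * y2)
     - (x2 ^+ 3 + a2 * x2 ^+ 2 + a4 * x2 + a6))).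
  by rewrite el; ring.
by rewrite e1 e2 !subrr.
Qed.

Definition ec_add (P Q : ec_point) : ec_point :=
  EcPoint (add_coords_on_curve (ec_pointP P) (ec_pointP Q)).

Definition ec_mul (n : nat) (P : ec_point) : ec_point :=
  iter n (ec_add P) ec_zero.

Definition ec_torsion (n : nat) : set ec_point :=
  [set P | ec_mul n P = ec_zero]%classic.

End Points.

Section BaseChange.
Variables (K M : fieldType) (f : {rmorphism K -> M}) (E : ell_curve K).

Lemma base_change_disc_neq0 :
  weierstrass_disc (f (ec_a1 E)) (f (ec_a2 E)) (f (ec_a3 E))
                   (f (ec_a4 E)) (f (ec_a6 E)) != 0.
Proof.
rewrite -[X in X != 0](_ : f (weierstrass_disc (ec_a1 E) (ec_a2 E) (ec_a3 E)
  (ec_a4 E) (ec_a6 E)) = _) ?fmorph_eq0 ?ec_disc_neq0 //.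
by rewrite /weierstrass_disc /=; ring.
Qed.

Definition base_change : ell_curve M := EllCurve base_change_disc_neq0.

Definition base_change_coords (P : option (K * K)) : option (M * M) :=
  omap (fun P => (f P.1, f P.2)) P.

Lemma base_change_on_curve (P : option (K * K)) :
  on_curve E P -> on_curve base_change (base_change_coords P).
Proof.
case: P => [[x y]|//] /= /eqP e; apply/eqP.
transitivity (f (y ^+ 2 + ec_a1 E * x * y + ec_a3 E * y)); first by ring.
by rewrite e; ring.
Qed.

Definition base_change_point (P : ec_point E) : ec_point base_change :=
  EcPoint (base_change_on_curve (ec_pointP P)).

End BaseChange.

(** Subfields of algC are represented by [divringClosed algC]. *)
Definition subfield_meet (C : divringClosed algC -> Prop) : {pred algC} :=
  fun x => `[< forall S : divringClosed algC, C S -> x \in S >].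

Lemma subfield_meet_divring_closed (C : divringClosed algC -> Prop) :
  divring_closed (subfield_meet C).
Proof.
split=> [|x y /asboolP Sx /asboolP Sy|x y /asboolP Sx /asboolP Sy];
  apply/asboolP => S CS; first exact: rpred1.
- by rewrite rpredB ?Sx ?Sy.
- by rewrite rpred_div ?Sx ?Sy.
Qed.
HB.instance Definition _ (C : divringClosed algC -> Prop) :=
  GRing.isDivringClosed.Build algC (subfield_meet C)
    (subfield_meet_divring_closed C).

Record subfield_elt (S : divringClosed algC) := SubfieldElt {
  subfield_val :> algC;
  subfield_valP : subfield_val \in S
}.
HB.instance Definition _ (S : divringClosed algC) :=
  [isSub for @subfield_val S].
HB.instance Definition _ (S : divringClosed algC) :=
  [Choice of subfield_elt S by <:].
HB.instance Definition _ (S : divringClosed algC) :=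
  [SubChoice_isSubIntegralDomain of subfield_elt S by <:].
HB.instance Definition _ (S : divringClosed algC) :=
  [SubIntegralDomain_isSubField of subfield_elt S by <:].

(** Automorphisms of the subfield S fixing k pointwise, where k is meant to be
    a subfield contained in S. S/k is not required to be finite, hence these
    groups are [groupType]s rather than groups 'Gal(E / K) of galois.v. *)
Section SubfieldGalois.
Variables (k : set algC) (S : divringClosed algC).

Definition is_sgal (s : subfield_elt S -> subfield_elt S) : Prop :=
  [/\ exists f : {rmorphism subfield_elt S -> subfield_elt S}, s = f,
      bijective s
    & forall x : subfield_elt S, k (val x) -> s x = x].

Record subfield_gal := SubfieldGal {
  sgal_fun :> subfield_elt S -> subfield_elt S;
  sgal_funP : `[< is_sgal sgal_fun >]
}.
HB.instance Definition _ := [isSub for sgal_fun].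
HB.instance Definition _ := [Choice of subfield_gal by <:].

Lemma is_sgal_id : `[< is_sgal id >].
Proof. by apply/asboolP; split=> //; [exists idfun | exists id]. Qed.

Lemma is_sgal_comp (s t : subfield_gal) : `[< is_sgal (s \o t) >].
Proof.
have /asboolP[[f sf] sbij sk] := sgal_funP s.
have /asboolP[[g tg] tbij tk] := sgal_funP t.
apply/asboolP; split; first by exists (f \o g); rewrite sf tg.
  exact: bij_comp.
by move=> x kx /=; rewrite tk // sk.
Qed.

Lemma is_sgal_inv (s : subfield_gal) :
  exists t : subfield_gal, cancel s t /\ cancel t s.
Proof.
have /asboolP[[f sf] [t st ts] sk] := sgal_funP s.
have fK : cancel f t by rewrite -sf.
have Kf : cancel t f by rewrite -sf.
have fI := can_inj fK.
have tB : zmod_morphism t.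
  by move=> x y; apply: fI; rewrite rmorphB !Kf.
have tM : monoid_morphism t.
  by split=> [|x y]; apply: fI; rewrite ?rmorph1 ?rmorphM !Kf.
pose tA := GRing.isZmodMorphism.Build _ _ t tB.
pose tMul := GRing.isMonoidMorphism.Build _ _ t tM.
pose tR : {rmorphism _ -> _} := HB.pack t tA tMul.
have tG : `[< is_sgal t >].
  apply/asboolP; split; [by exists tR | by exists s |].
  by move=> x kx; rewrite -[in LHS](sk x kx) st.
by exists (SubfieldGal tG).
Qed.

Definition sgal_one : subfield_gal := SubfieldGal is_sgal_id.
Definition sgal_mul (s t : subfield_gal) : subfield_gal := SubfieldGal (is_sgal_comp s t).
Definition sgal_inv (s : subfield_gal) : subfield_gal := sval (cid (is_sgal_inv s)).

Lemma sgal_mulA : associative sgal_mul.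
Proof. by move=> s t u; apply: val_inj. Qed.
Lemma sgal_mul1 : left_id sgal_one sgal_mul.
Proof. by move=> s; apply: val_inj. Qed.
Lemma sgal_mulr1 : right_id sgal_one sgal_mul.
Proof. by move=> s; apply: val_inj. Qed.
Lemma sgal_mulV : left_inverse sgal_one sgal_inv sgal_mul.
Proof.
move=> s; apply: val_inj; apply/funext => x /=.
by rewrite /sgal_inv; case: cid => t [/= st ts]; rewrite st.
Qed.
Lemma sgal_mulrV : right_inverse sgal_one sgal_inv sgal_mul.
Proof.
move=> s; apply: val_inj; apply/funext => x /=.
by rewrite /sgal_inv; case: cid => t [/= st ts]; rewrite ts.
Qed.

HB.instance Definition _ := isGroup.Build subfield_gal
  sgal_mulA sgal_mul1 sgal_mulr1 sgal_mulV sgal_mulrV.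

End SubfieldGalois.

Record normal_subgroup (H : groupType) := NormalSubgroup {
  nsub :> groupClosed H;
  nsubJ : forall x y : H, x \in nsub -> (x ^ y)%g \in nsub
}.

Section Quotient.
Variables (H : groupType) (N : normal_subgroup H).
Local Open Scope group_scope.

Definition qcoset_rel : rel H := fun x y => x^-1 * y \in nsub N.

Lemma qcoset_rel_refl : reflexive qcoset_rel.
Proof. by move=> x; rewrite /qcoset_rel mulVg gpred1. Qed.
Lemma qcoset_rel_sym : symmetric qcoset_rel.
Proof. by move=> x y; rewrite /qcoset_rel -gpredV invgM invgK. Qed.
Lemma qcoset_rel_trans : transitive qcoset_rel.
Proof.
move=> y x z xy yz; have := gpredM _ _ xy yz.
by rewrite -mulgA mulVKg.
Qed.

Canonical qcoset_equiv :=
  EquivRel qcoset_rel qcoset_rel_refl qcoset_rel_sym qcoset_rel_trans.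

Definition quotg := {eq_quot qcoset_equiv}%qT.
HB.instance Definition _ := Choice.on quotg.

Definition qcoset_of (x : H) : quotg := (\pi_({eq_quot qcoset_equiv}) x)%qT.
Definition qcoset_repr (a : quotg) : H :=
  @repr _ {eq_quot qcoset_equiv}%qT a.

Lemma qcoset_reprK (a : quotg) : qcoset_of (qcoset_repr a) = a.
Proof. exact: reprK. Qed.

Lemma qcoset_ofP (x y : H) : (qcoset_of x = qcoset_of y) <-> (x^-1 * y \in nsub N).
Proof. by split=> [/eqmodP | xy]; [ | apply/eqmodP]. Qed.

Definition quotg_one : quotg := qcoset_of 1.
Definition quotg_mul (a b : quotg) : quotg :=
  qcoset_of (qcoset_repr a * qcoset_repr b).
Definition quotg_inv (a : quotg) : quotg :=
  qcoset_of (qcoset_repr a)^-1.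

Lemma qcoset_ofM (x y : H) :
  qcoset_of (x * y) = quotg_mul (qcoset_of x) (qcoset_of y).
Proof.
rewrite /quotg_mul.
set x' := qcoset_repr (qcoset_of x); set y' := qcoset_repr (qcoset_of y).
have /qcoset_ofP ex : qcoset_of x = qcoset_of x' by rewrite qcoset_reprK.
have /qcoset_ofP ey : qcoset_of y = qcoset_of y' by rewrite qcoset_reprK.
apply/qcoset_ofP.
have -> : (x * y)^-1 * (x' * y') = (x^-1 * x') ^ y * (y^-1 * y').
  by rewrite conjgE invgM -!mulgA mulVKg.
by rewrite gpredM // nsubJ.
Qed.

Lemma qcoset_ofV (x : H) : qcoset_of x^-1 = quotg_inv (qcoset_of x).
Proof.
rewrite /quotg_inv; set x' := qcoset_repr _.
have /qcoset_ofP ex : qcoset_of x' = qcoset_of x by rewrite qcoset_reprK.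
apply/qcoset_ofP; rewrite invgK.
have -> : x * x'^-1 = (x'^-1 * x) ^ x'^-1.
  by rewrite conjgE invgK mulgA mulVKg.
exact: nsubJ.
Qed.

Lemma quotg_mulA : associative quotg_mul.
Proof.
move=> a b c; rewrite -[a]qcoset_reprK -[b]qcoset_reprK -[c]qcoset_reprK.
by rewrite -!qcoset_ofM mulgA.
Qed.
Lemma quotg_mul1 : left_id quotg_one quotg_mul.
Proof. by move=> a; rewrite -[a]qcoset_reprK -qcoset_ofM mul1g. Qed.
Lemma quotg_mulr1 : right_id quotg_one quotg_mul.
Proof. by move=> a; rewrite -[a]qcoset_reprK -qcoset_ofM mulg1. Qed.
Lemma quotg_mulV : left_inverse quotg_one quotg_inv quotg_mul.
Proof. by move=> a; rewrite -[a]qcoset_reprK -qcoset_ofV -qcoset_ofM mulVg. Qed.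
Lemma quotg_mulrV : right_inverse quotg_one quotg_inv quotg_mul.
Proof. by move=> a; rewrite -[a]qcoset_reprK -qcoset_ofV -qcoset_ofM mulgV. Qed.

HB.instance Definition _ := isGroup.Build quotg
  quotg_mulA quotg_mul1 quotg_mulr1 quotg_mulV quotg_mulrV.

End Quotient.

Definition isomorphic_to_quotient (G H : groupType) : Prop :=
  exists (N : normal_subgroup H) (f : quotg N -> G),
    bijective f /\ {morph f : x y / (x * y)%g}.

(** An embedding of a number field F in algC makes algC an algebraic closure
    of F; in particular every subfield of algC is algebraic over F, so that
    [normal_over] need not require it. *)

Section NumberField.
Variables (F : fieldExtType rat) (iota : {rmorphism F -> algC}).

Definition normal_over (S : divringClosed algC) : Prop :=
  (forall a : F, iota a \in S) /\
  forall q : {poly F}, irreducible_poly q ->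
    (exists2 x, x \in S & root (map_poly iota q) x) ->
    forall y, root (map_poly iota q) y -> y \in S.

(** The smallest normal extension of F containing the subset A. *)
Definition normal_closure (A : set algC) : divringClosed algC :=
  subfield_meet (fun S => normal_over S /\ forall x, A x -> x \in S).

Definition torsion_coords (E : ell_curve F) (n : nat) : set algC :=
  [set z | exists P : ec_point (base_change iota E), exists x y : algC,
     [/\ ec_torsion n P, ec_coords P = Some (x, y) & z = x \/ z = y]]%classic.

Definition torsion_field (E : ell_curve F) (n : nat) : divringClosed algC :=
  subfield_meet (fun S =>
    (forall a : F, iota a \in S)
    /\ forall z, torsion_coords E n z -> z \in S).

End NumberField.

(* Main.v *)
From HB Require Import structures.
Require Import Defs.
From mathcomp Require Import all_boot all_order all_algebra all_field.
From mathcomp Require Import boolp classical_sets.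

Set Implicit Arguments.
Unset Strict Implicit.
Unset Printing Implicit Defensive.

Import GRing.Theory.
Local Open Scope ring_scope.
Local Open Scope classical_set_scope.

(** If a [p]-torsion point of [E] over [L] has a coordinate [z] outside [F],
    then [L = F(z)] since there are no intermediate fields, so [L], and hence
    its normal closure [N], lies in [F(E[p])], which is normal over [F] because
    the automorphisms of [algC] over [F] permute the torsion points.
    Restriction to [N] then maps the Galois group of [F(E[p])] onto that of
    [N], because every automorphism of [N] extends to [algC]. *)

(** * Number fields large enough to contain given algebraic numbers *)

Lemma splitting_num_field_exists (s : seq algC) :
  exists (Qs : splittingFieldType rat) (QsC : {rmorphism Qs -> algC}),
    {in s, forall x, exists y, QsC y = x}.
Proof.
(* [P] is a product of rational minimal polynomials of the elements of [s]. Generating a number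
   field by all the roots of [P], and not by [s] alone, makes it a splitting field. *)
have [P P0 sP] : exists2 P : {poly rat}, P != 0
    & {in s, forall x, root (map_poly ratr P) x}.
  elim: s => [|x s [P P0 IH]]; first by exists 1; rewrite ?oner_eq0.
  have [r [_ mon_r] dv_r] := minCpolyP x.
  exists (r * P) => [|y]; first by rewrite mulf_neq0 // monic_neq0.
  rewrite rmorphM rootM inE => /predU1P[->|/IH->]; last by rewrite orbT.
  by rewrite dv_r dvdpp.
have [R DR] := closed_field_poly_normal (map_poly ratr P : {poly algC}).
have nzl : lead_coef (map_poly ratr P : {poly algC}) != 0.
  by rewrite lead_coef_eq0 map_poly_eq0.
have [Qs [QsC [R1 DR1 genQs]]] := num_field_exists R.
have splitQs : SplittingField.axiom Qs.
  exists (map_poly (in_alg Qs) P).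
    by apply/polyOverP=> i; rewrite coef_map memvZ ?mem1v.
  exists R1; last exact: genQs.
  rewrite -(eqp_map QsC) -map_poly_comp (eq_map_poly (fmorph_eq_rat _)) DR.
  rewrite rmorph_prod -DR1 big_map /=.
  under [X in _ %= X]eq_bigr do rewrite map_polyXsubC.
  exact: eqp_scale.
pose QsF := FieldExt_isSplittingField.Build rat Qs splitQs.
pose Qs' : splittingFieldType rat := HB.pack (FieldExt.sort Qs) QsF.
exists Qs', QsC => x /sP; rewrite DR rootZ // root_prod_XsubC -DR1.
by case/mapP=> y _ ->; exists y.
Qed.

(** Both embeddings are linear over the rationals, so it is enough that a basis of [F] lands in the
    image of [QsC]. Injectivity of [QsC] then makes [phi] a morphism. *)
Lemma num_field_embedding_factor (F Qs : fieldExtType rat)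
    (iota : {rmorphism F -> algC}) (QsC : {rmorphism Qs -> algC}) :
  {in vbasis {:F}, forall b, exists y, QsC y = iota b} ->
  exists phi : {rmorphism F -> Qs}, forall a, QsC (phi a) = iota a.
Proof.
move=> QsC_b.
have QsC_F (a : F) : exists y, QsC y == iota a.
  have y_ (i : 'I_(\dim {:F})) : exists y, QsC y == iota (vbasis {:F})`_i.
    have [|y Dy] := QsC_b (vbasis {:F})`_i; last by exists y; apply/eqP.
    by rewrite mem_nth ?size_tuple.
  exists (\sum_i coord (vbasis {:F}) i a *: xchoose (y_ i)).
  rewrite [in iota a](coord_vbasis (memvf a)) !rmorph_sum /=.
  apply/eqP/eq_bigr => i _; rewrite !rmorphZ_num.
  by rewrite (eqP (xchooseP (y_ i))).
pose phi a := xchoose (QsC_F a).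
have phiE a : QsC (phi a) = iota a by apply/eqP/(xchooseP (QsC_F a)).
have phiB : zmod_morphism phi.
  by move=> a b; apply: (fmorph_inj QsC); rewrite !(phiE, rmorphB).
have phiM : monoid_morphism phi.
  by split=> [|a b]; apply: (fmorph_inj QsC); rewrite !(phiE, rmorph1, rmorphM).
pose phiA := GRing.isZmodMorphism.Build _ _ phi phiB.
pose phiMul := GRing.isMonoidMorphism.Build _ _ phi phiM.
pose phiR : {rmorphism F -> Qs} := HB.pack phi phiA phiMul.
by exists phiR.
Qed.

(** * Conjugation over a number field embedded in [algC] *)

Section Conjugation.
Variables (F : fieldExtType rat) (iota : {rmorphism F -> algC}).

Lemma algC_irreducible_root (x : algC) :
  exists2 q : {poly F}, irreducible_poly q & root (map_poly iota q) x.
Proof.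
have [r [_ mon_r] dv_r] := minCpolyP x.
have [q q0 qx] : exists2 q : {poly F}, q != 0 & root (map_poly iota q) x.
  exists (map_poly (in_alg F) r); first by rewrite map_poly_eq0 monic_neq0.
  by rewrite -map_poly_comp (eq_map_poly (fmorph_eq_rat _)) dv_r dvdpp.
(* Descent on the size of [q]: a nonzero polynomial of least degree vanishing at [x] is
   irreducible. *)
have [n] := ubnP (size q); elim: n => // n IHn in q q0 qx *.
move=> szq; have [|min_q] := EM (exists2 q1 : {poly F}, q1 != 0 &
    root (map_poly iota q1) x /\ (size q1 < size q)%N).
  case=> q1 nz1 [q1x lt1]; apply: (IHn q1) => //.
  exact: leq_trans lt1 szq.
exists q => //; apply/(subfx_irreducibleP qx q0) => q1 q1x nz1.
by rewrite leqNgt; apply/negP => lt1; apply: min_q; exists q1.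
Qed.

(** Finite Galois theory applies in a splitting number field [Qs] containing [F], [x] and [y]; the
    automorphism of [Qs] found there extends to [algC]. *)
Lemma algC_conjugate (q : {poly F}) (x y : algC) :
    irreducible_poly q ->
    root (map_poly iota q) x -> root (map_poly iota q) y ->
  exists2 nu : {rmorphism algC -> algC},
    forall a, nu (iota a) = iota a & nu x = y.
Proof.
move=> irr_q qx qy.
have [Qs [QsC sQs]] :=
  splitting_num_field_exists [:: x, y & map iota (vbasis {:F})].
have [|phi phiE] := @num_field_embedding_factor F Qs iota QsC.
  by move=> b b_F; apply: sQs; rewrite !inE map_f ?orbT.
have [|x1 Dx] := sQs x; first by rewrite inE eqxx.
have [|y1 Dy] := sQs y; first by rewrite !inE eqxx orbT.
have phiZ : scalable phi by apply: fmorph_numZ.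
pose phiL := GRing.isScalable.Build _ _ _ _ phi phiZ.
pose phiLR : {lrmorphism F -> Qs} := HB.pack (GRing.RMorphism.sort phi) phiL.
(* [K] is the copy of [F] inside [Qs], built as a subspace so that the Galois theory of subfields of
   [Qs] applies over it. *)
pose K := (linfun phiLR @: fullv)%VS.
have memK z : reflect (exists a, z = phi a) (z \in K).
  apply: (iffP memv_imgP) => [[a _ ->] | [a ->]];
    by exists a; rewrite ?lfunE ?memvf.
have algK : is_aspace K.
  rewrite /is_aspace has_algid1; last first.
    by apply/memK; exists 1; rewrite rmorph1.
  apply/prodvP=> _ _ /memK[a ->] /memK[b ->].
  by apply/memK; exists (a * b); rewrite rmorphM.
pose Ka := ASpace algK.
have mapE p : map_poly QsC (map_poly phi p) = map_poly iota p.
  by rewrite -map_poly_comp; apply: eq_map_poly.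
have [m Dm] : exists m, minPoly Ka x1 = map_poly phi m.
  have cP i : exists a, (minPoly Ka x1)`_i == phi a.
    by have /memK[a ->] := polyOverP (minPolyOver Ka x1) i; exists a.
  exists (\poly_(i < size (minPoly Ka x1)) xchoose (cP i)).
  apply/polyP=> i; rewrite coef_map coef_poly /=.
  case: ltnP => [_|le_i]; first by rewrite -(eqP (xchooseP (cP i))).
  by rewrite nth_default // rmorph0.
(* The minimal polynomial [m] is not constant and divides the irreducible [q], so they agree up to a
   unit, and [y1] is a root of [m] too. *)
have m_q : m %= q.
  have [_ irrq] := irr_q; apply: irrq.
    rewrite -(size_map_poly phi) -Dm size_minPoly eqSS.
    by rewrite -lt0n adjoin_degreeE divn_gt0 ?adim_gt0 // dimvS ?subv_adjoin.
  rewrite -(dvdp_map phi) -Dm minPoly_dvdp //.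
    by apply/polyOverP=> i; apply/memK; rewrite coef_map; exists q`_i.
  by rewrite -(fmorph_root QsC) mapE Dx.
have my : root (minPoly Ka x1) y1.
  rewrite -(fmorph_root QsC) Dy Dm mapE.
  by have := m_q; rewrite -(eqp_map iota) => /eqp_root->.
have [g gK gx] := normalField_root_minPoly (subvf Ka) (normalFieldf Ka)
  (memvf x1) my.
have [nu nuE] := extend_algC_subfield_aut QsC (g : {rmorphism Qs -> Qs}).
exists nu => [a|]; last by rewrite -Dx -nuE /= gx.
rewrite -phiE -nuE /= (fixed_gal (subvf Ka) gK) //.
by apply/memK; exists a.
Qed.

End Conjugation.

(** * Quotients *)

(** This is the first isomorphism theorem: the cosets of the kernel are the fibres of [phi], so
    evaluating [phi] at a representative does not depend on the choice. *)
Lemma surjective_isomorphic_to_quotient (G H : groupType) (phi : H -> G) :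
  {morph phi : x y / (x * y)%g} -> (forall g, exists h, phi h = g) ->
  isomorphic_to_quotient G H.
Proof.
move=> phiM phi_onto.
have phi1 : phi 1%g = 1%g by apply: (mulgI (phi 1%g)); rewrite -phiM !mulg1.
have phiV x : phi x^-1%g = (phi x)^-1%g.
  by apply: (mulgI (phi x)); rewrite -phiM !mulgV.
pose ker : {pred H} := [pred x | phi x == 1%g].
have kerM : mulg_closed ker.
  by move=> x y /eqP x1 /eqP y1; rewrite inE phiM x1 y1 mulg1.
have ker1 : 1%g \in ker by rewrite inE phi1.
have kerV : invg_closed ker by move=> x /eqP x1; rewrite inE phiV x1 invg1.
pose kerM' := isMulClosed.Build H ker kerM.
pose ker1' := isMul1Closed.Build H ker ker1.
pose kerV' := isInvClosed.Build H ker kerV.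
pose kerG : groupClosed H := HB.pack ker kerM' ker1' kerV'.
have kerJ (x y : H) : x \in kerG -> (x ^ y)%g \in kerG.
  by rewrite !inE conjgE !phiM phiV => /eqP->; rewrite mul1g mulVg.
pose N := NormalSubgroup kerJ.
have eq_phi x y : (qcoset_of N x = qcoset_of N y) <-> phi x = phi y.
  split=> [/qcoset_ofP | xy].
    rewrite inE phiM phiV => /eqP xy.
    by rewrite -[phi y](mulVKg (phi x)) xy mulg1.
  by apply/qcoset_ofP; rewrite inE phiM phiV xy mulVg.
pose f (q : quotg N) := phi (qcoset_repr q).
have fE x : f (qcoset_of N x) = phi x by apply/eq_phi; rewrite qcoset_reprK.
exists N, f; split.
  exists (fun g => qcoset_of N (sval (cid (phi_onto g)))) => [q | g].
    by rewrite -[RHS]qcoset_reprK; apply/eq_phi; case: cid.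
  by rewrite fE; case: cid.
by move=> x y; rewrite /f -phiM; apply: fE.
Qed.

(** * Normal subfields and their automorphisms *)

Section NormalSubfields.
Variables (F : fieldExtType rat) (iota : {rmorphism F -> algC}).
Implicit Types (A : set algC) (S N T : divringClosed algC).
Implicit Types nu : {rmorphism algC -> algC}.

Lemma divring_closed_preim nu S : divring_closed [pred x | nu x \in S].
Proof.
split=> [|y z yP zP|y z yP zP]; rewrite inE; first by rewrite rmorph1 rpred1.
  by rewrite rmorphB rpredB.
by rewrite fmorph_div rpred_div.
Qed.

(** The body has the shape of [torsion_field], which is thus the instance at [torsion_coords] by
    conversion. *)
Definition generated_subfield A : divringClosed algC :=
  subfield_meet (fun S =>
    (forall a, iota a \in S) /\ forall z, A z -> z \in S).

Lemma generated_subfield_base A a : iota a \in generated_subfield A.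
Proof. by apply/asboolP => S [SF _]. Qed.

Lemma generated_subfield_mem A z : A z -> z \in generated_subfield A.
Proof. by move=> Az; apply/asboolP => S [_]; apply. Qed.

(** Minimality, for a bare predicate with a proof of closure, so that it applies directly to sets
    such as the preimage of a subfield under an automorphism. *)
Lemma generated_subfield_sub A (P : {pred algC}) :
    divring_closed P -> (forall a, iota a \in P) -> (forall z, A z -> z \in P) ->
  {subset generated_subfield A <= P}.
Proof.
move=> Pdiv PF PA x /asboolP.
pose Pc := GRing.isDivringClosed.Build algC P Pdiv.
pose S : divringClosed algC := HB.pack P Pc.
by move=> /(_ S); apply.
Qed.

Lemma generated_subfield_stable A nu :
    (forall a, nu (iota a) = iota a) -> (forall z, A z -> A (nu z)) ->
  forall x, x \in generated_subfield A -> nu x \in generated_subfield A.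
Proof.
move=> nuF nuA x Ax.
apply: (generated_subfield_sub (divring_closed_preim nu _) _ _ Ax) => [a|z Az].
  suff: nu (iota a) \in generated_subfield A by [].
  by rewrite nuF generated_subfield_base.
exact: generated_subfield_mem (nuA z Az).
Qed.

(** Two roots of an irreducible polynomial are exchanged by some automorphism of [algC] over [F],
    and such an automorphism preserves the generated field because it preserves [A]. *)
Lemma generated_subfield_normal A :
    (forall nu, (forall a, nu (iota a) = iota a) -> forall z, A z -> A (nu z)) ->
  normal_over iota (generated_subfield A).
Proof.
move=> nuA; split=> [|q irr_q [x Ax qx] y qy].
  exact: generated_subfield_base.
have [nu nuF <-] := algC_conjugate irr_q qx qy.
exact: (generated_subfield_stable nuF (nuA nu nuF) Ax).
Qed.

(* [g] is an [F]-morphism; since [F] is only embedded in [S], this is stated on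
   the elements of [S] that lie over [F]. *)
Lemma root_fixing (S : divringClosed algC) (g : {rmorphism subfield_elt S -> algC})
    (q : {poly F}) (x : subfield_elt S) :
    (forall a, iota a \in S) -> (forall y a, val y = iota a -> g y = iota a) ->
  root (map_poly iota q) (val x) -> root (map_poly iota q) (g x).
Proof.
move=> SF gF; pose h a := SubfieldElt (SF a).
have gh a : g (h a) = iota a by apply: gF.
(* With coefficients lifted to [S], the value of [q] is the image of one and the same element of [S]
   for [k = g] and for [k = val]. Injectivity of [val] shows that this element is zero. *)
have horner_h (k : {rmorphism subfield_elt S -> algC}) :
    (forall a, k (h a) = iota a) ->
  (map_poly iota q).[k x] = k (\sum_(i < size q) h q`_i * x ^+ i).
  move=> kh; rewrite (@horner_coef_wide _ (size q)) ?size_map_poly //.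
  rewrite rmorph_sum; apply: eq_bigr => i _.
  by rewrite rmorphM rmorphXn kh coef_map.
rewrite !rootE horner_h // (horner_h val) // => /eqP.
rewrite -[RHS](rmorph0 (val : {rmorphism subfield_elt S -> algC})).
by move=> /fmorph_inj->; rewrite rmorph0.
Qed.

(** The image [nu x] is a root of the same irreducible polynomial over [F] as [x]. *)
Lemma normal_over_stable S nu :
    normal_over iota S -> (forall a, nu (iota a) = iota a) ->
  forall x, x \in S -> nu x \in S.
Proof.
move=> [SF Snorm] nuF x Sx.
have [q irr_q qx] := algC_irreducible_root iota x.
apply: (Snorm q irr_q); first by exists x.
have <- : map_poly nu (map_poly iota q) = map_poly iota q.
  by rewrite -map_poly_comp; apply: eq_map_poly.
by rewrite fmorph_root.
Qed.

Lemma normal_over_image S N (g : {rmorphism subfield_elt S -> algC}) x :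
    normal_over iota N -> (forall a, iota a \in S) ->
    (forall y a, val y = iota a -> g y = iota a) -> val x \in N ->
  g x \in N.
Proof.
move=> [_ Nnorm] SF gF Nx.
have [q irr_q qx] := algC_irreducible_root iota (val x).
by apply: (Nnorm q irr_q); [exists (val x) | exact: root_fixing].
Qed.

(** Galois elements are built from morphisms into [algC]; injectivity is automatic for fields, so
    only the image has to be controlled. *)
Lemma sgal_exists S (g : {rmorphism subfield_elt S -> algC}) :
    (forall x, g x \in S) -> (forall y : subfield_elt S, exists x, g x = val y) ->
    (forall y a, val y = iota a -> g y = iota a) ->
  exists s : subfield_gal (range iota) S, forall x, val (s x) = g x.
Proof.
move=> gS g_onto gF; pose f x := SubfieldElt (gS x).
have valf x : val (f x) = g x by [].
have fB : zmod_morphism f.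
  by move=> x y; apply: val_inj; rewrite /= rmorphB.
have fM : monoid_morphism f.
  by split=> [|x y]; apply: val_inj; rewrite /= ?rmorph1 ?rmorphM.
pose fA := GRing.isZmodMorphism.Build _ _ f fB.
pose fMul := GRing.isMonoidMorphism.Build _ _ f fM.
pose fR : {rmorphism subfield_elt S -> subfield_elt S} := HB.pack f fA fMul.
have fP : `[< is_sgal (range iota) f >].
  apply/asboolP; split; first by exists fR.
    exists (fun y => sval (cid (g_onto y))) => [x | y]; case: cid => z /= gz.
      exact: (fmorph_inj g).
    exact: val_inj.
  by move=> x [a _ Da]; apply: val_inj; rewrite valf (gF x a).
by exists (SubfieldGal fP).
Qed.

Lemma sgal_val_fixing S (s : subfield_gal (range iota) S) y a :
  val y = iota a -> val (s y) = iota a.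
Proof.
move=> Dy; have /asboolP[_ _ sF] := sgal_funP s.
by rewrite sF //; exists a.
Qed.

Lemma sgal_rmorphism k S (s : subfield_gal k S) :
  exists g : {rmorphism subfield_elt S -> algC}, forall x, g x = val (s x).
Proof.
have /asboolP[[f sf] _ _] := sgal_funP s.
by exists (val \o f) => x; rewrite sf.
Qed.

Lemma sgal_of_aut T nu :
    normal_over iota T -> (forall a, nu (iota a) = iota a) ->
  exists s : subfield_gal (range iota) T, forall x, val (s x) = nu (val x).
Proof.
move=> nT nuF; apply: (@sgal_exists T (nu \o val)) => [x | y | y a Dy] /=.
- exact: normal_over_stable (valP x).
(* Surjectivity: the inverse of [nu] also fixes [F], hence also preserves the normal field [T]. *)
- pose nu' : {rmorphism algC -> algC} := algC_invaut nu.
  have nu'y : nu' (val y) \in T.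
    apply: normal_over_stable (valP y) => // a.
    by rewrite -[in LHS](nuF a) /= algC_autK.
  by exists (SubfieldElt nu'y); rewrite /= algC_invautK.
- by rewrite Dy.
Qed.

Lemma sgal_restrict N T (s : subfield_gal (range iota) T) :
    normal_over iota N -> {subset N <= T} -> (forall a, iota a \in T) ->
  exists s' : subfield_gal (range iota) N,
    forall x y, val x = val y -> val (s' x) = val (s y).
Proof.
move=> nN NT TF; pose inc (x : subfield_elt N) := SubfieldElt (NT _ (valP x)).
have incB : zmod_morphism inc by move=> x y; apply: val_inj.
have incM : monoid_morphism inc by split=> [|x y]; apply: val_inj.
pose incA := GRing.isZmodMorphism.Build _ _ inc incB.
pose incMul := GRing.isMonoidMorphism.Build _ _ inc incM.
pose incR : {rmorphism subfield_elt N -> subfield_elt T} :=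
  HB.pack inc incA incMul.
(* Stated for every [t], since it is used for [s] and, to get surjectivity on [N], for the inverse
   of [s]. *)
have sN (t : subfield_gal (range iota) T) y : val y \in N -> val (t y) \in N.
  have [g gE] := sgal_rmorphism t; rewrite -gE.
  by apply: (normal_over_image nN TF) => z a; rewrite gE; apply: sgal_val_fixing.
have [g gE] := sgal_rmorphism s.
have [x | y | y a Dy | s' s'E] := @sgal_exists N (g \o incR).
- by rewrite /= gE sN //= (valP x).
- have [t [st ts]] := is_sgal_inv s.
  have ty : val (t (inc y)) \in N by rewrite sN //= (valP y).
  exists (SubfieldElt ty); rewrite /= gE -[RHS]/(val (inc y)) -[in RHS](ts (inc y)).
  by congr (val (s _)); apply: val_inj.
- by rewrite /= gE; apply: sgal_val_fixing.
- exists s' => x y Dxy; rewrite s'E /= gE; congr (val (s _)).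
  exact: val_inj.
Qed.

(** The last hypothesis, together with [a \in N], expresses [N = F(a)]. An automorphism of [N] is
    then determined by the image of [a], a conjugate of [a], and so comes from an automorphism of
    [algC], which also restricts to [T]. *)
Lemma normal_isomorphic_to_quotient N T (a : algC) :
    normal_over iota N -> normal_over iota T -> {subset N <= T} -> a \in N ->
    (forall P, divring_closed P -> (forall b, iota b \in P) -> a \in P ->
       {subset N <= P}) ->
  isomorphic_to_quotient (subfield_gal (range iota) N)
    (subfield_gal (range iota) T).
Proof.
move=> nN nT NT Na genN; have [TF _] := nT; have [NF _] := nN.
pose phi s := sval (cid (sgal_restrict s nN NT TF)).
have phiE s x y : val x = val y -> val (phi s x) = val (s y).
  by rewrite /phi; case: cid => s' /=; apply.
apply: (@surjective_isomorphic_to_quotient _ _ phi) => [s t | s].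
  apply: val_inj; apply/funext => x; apply: val_inj.
  have yP := NT _ (valP x); rewrite (phiE _ x (SubfieldElt yP)) //=.
  by apply/esym/phiE/phiE.
have [g gE] := sgal_rmorphism s.
have gF y b : val y = iota b -> g y = iota b.
  by rewrite gE; apply: sgal_val_fixing.
have [q irr_q qa] := algC_irreducible_root iota a.
have [nu nuF nua] := algC_conjugate irr_q qa
  (root_fixing (x := SubfieldElt Na) NF gF qa).
have [s' s'E] := sgal_of_aut nT nuF.
exists s'; apply: val_inj; apply/funext => x; apply: val_inj.
have yP := NT _ (valP x); rewrite (phiE _ x (SubfieldElt yP)) // s'E -gE /=.
(* [P] is the set of elements of [N] on which [s] and [nu] agree. It is a subfield containing [F]
   and [a], hence all of [N]. *)
pose P : {pred algC} :=
  [pred z | `[< exists2 y : subfield_elt N, val y = z & g y = nu z >]].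
suff: val x \in P by case/asboolP=> y /val_inj->.
apply: (genN P) (valP x) => [|b|]; last by apply/asboolP; exists (SubfieldElt Na).
  split=> [|_ _ /asboolP[y <- gy] /asboolP[z <- gz]
           |_ _ /asboolP[y <- gy] /asboolP[z <- gz]]; apply/asboolP.
  - by exists 1; rewrite ?rmorph1.
  - by exists (y - z); rewrite ?rmorphB //= gy gz.
  - by exists (y / z); rewrite ?fmorph_div //= gy gz.
apply/asboolP; exists (SubfieldElt (NF b)) => //.
by rewrite nuF; apply: gF.
Qed.

(** [R] collects all roots of irreducible polynomials over [F] vanishing at the elements of [s];
    automorphisms over [F] permute the roots of each. *)
Lemma algC_conjugates (s : seq algC) :
  exists2 R : seq algC, {subset s <= R} &
    forall nu, (forall a, nu (iota a) = iota a) -> {in R, forall x, nu x \in R}.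
Proof.
elim: s => [|x s [R sR nuR]]; first by exists [::].
have [q [q_gt1 _] qx] := algC_irreducible_root iota x.
have q0 : map_poly iota q != 0.
  by rewrite map_poly_eq0 -size_poly_gt0 (ltn_trans _ q_gt1).
have [R1 DR1] := closed_field_poly_normal (map_poly iota q).
have memR1 y : (y \in R1) = root (map_poly iota q) y.
  by rewrite DR1 rootZ ?lead_coef_eq0 // root_prod_XsubC.
exists (R1 ++ R) => [y | nu nuF y].
  rewrite inE mem_cat => /predU1P[->|/sR->]; last by rewrite orbT.
  by rewrite memR1 qx.
rewrite !mem_cat => /orP[|/(nuR nu nuF)->]; last by rewrite orbT.
rewrite !memR1 => qy; have <- : map_poly nu (map_poly iota q) = map_poly iota q.
  by rewrite -map_poly_comp; apply: eq_map_poly.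
by rewrite fmorph_root qy.
Qed.

Lemma normal_closure_normal A : normal_over iota (normal_closure iota A).
Proof.
split=> [a | q irr_q [x Nx qx] y qy]; apply/asboolP => S [nS AS].
  by have [] := nS.
have [_ Snorm] := nS; apply: (Snorm q irr_q) qy; exists x => //.
by have /asboolP := Nx; apply.
Qed.

(** When finitely many elements of [A] generate it over [F], their conjugates generate the normal
    closure, and the primitive element theorem replaces these by a single [a]. *)
Lemma normal_closure_primitive A (s : seq algC) :
    (forall x, x \in s -> A x) ->
    (forall S, (forall b, iota b \in S) -> {subset s <= S} ->
       forall x, A x -> x \in S) ->
  exists2 a, a \in normal_closure iota A &
    forall P, divring_closed P -> (forall b, iota b \in P) -> a \in P ->
      {subset normal_closure iota A <= P}.
Proof.
move=> sA genA; have nN := normal_closure_normal A.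
have AN z : A z -> z \in normal_closure iota A.
  by move=> Az; apply/asboolP => S [_]; apply.
have [N DN] : exists N : divringClosed algC, N = normal_closure iota A.
  by exists (normal_closure iota A).
rewrite -DN in nN AN *; have [R sR nuR] := algC_conjugates s.
(* By [Da], [a] is an integral combination of the conjugates in [N], so it lies in [N]; by [Ds],
   each of these conjugates is a rational polynomial in [a]. *)
have [a /sig_eqW[c Da] /sig_eqW[ps Ds]] := algC_PET [seq x <- R | x \in N].
exists a => [|P Pdiv PF Pa].
  rewrite Da; apply: rpred_sum => i _; apply: rpredMn.
  by have := mem_nth 0 (ltn_ord i); rewrite mem_filter => /andP[].
(* [G = F(a)] is normal because the conjugates of [s] lying in [N] are permuted
   by the automorphisms over [F]. *)
pose G := generated_subfield [set x | x \in R /\ x \in N].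
have nG : normal_over iota G.
  apply: generated_subfield_normal => nu nuF z [Rz Nz]; split.
    exact: nuR.
  exact: normal_over_stable Nz.
have GP : {subset G <= P}.
  apply: generated_subfield_sub => // z [Rz Nz].
  have: z \in [seq x <- R | x \in N] by rewrite mem_filter Nz.
  pose Pc := GRing.isDivringClosed.Build algC P Pdiv.
  pose S : divringClosed algC := HB.pack P Pc.
  rewrite Ds => /mapP[p _ ->]; apply: (rpred_horner (S := S)) => //.
  by apply/polyOverP=> i; rewrite coef_map /= -(fmorph_eq_rat (iota \o in_alg F)); apply: PF.
have AG z : A z -> z \in G.
  apply: genA => [b|x sx]; first exact: generated_subfield_base.
  by apply: generated_subfield_mem; split; [apply: sR | apply/AN/sA].
(* [G] is one of the normal fields whose intersection is the normal closure. *)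
by rewrite DN => x /asboolP/(_ G (conj nG AG))/GP.
Qed.

End NormalSubfields.

(** * Torsion points *)

Section CoordinateMap.
Variables (K M : fieldType) (f : {rmorphism K -> M}).
Variables (E : ell_curve K) (E' : ell_curve M).
(** Only matching coefficients are assumed, so that both an extension of the base field and an
    automorphism of [algC] acting on a single curve are covered. *)
Hypotheses (f1 : f (ec_a1 E) = ec_a1 E') (f2 : f (ec_a2 E) = ec_a2 E').
Hypotheses (f3 : f (ec_a3 E) = ec_a3 E') (f4 : f (ec_a4 E) = ec_a4 E').
Hypothesis f6 : f (ec_a6 E) = ec_a6 E'.

Lemma base_change_coords_inj : injective (base_change_coords f).
Proof.
by move=> [[x y]|] [[x' y']|] //= [/fmorph_inj-> /fmorph_inj->].
Qed.

Lemma base_change_coords_on_curve P :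
  on_curve E' (base_change_coords f P) = on_curve E P.
Proof.
case: P => [[x y]|//] /=; rewrite -f1 -f2 -f3 -f4 -f6.
by rewrite -!rmorphXn -!(rmorphM, rmorphD) (inj_eq (fmorph_inj f)).
Qed.

(** The addition formulas are rational in the coordinates and coefficients, and an injective [f]
    preserves and reflects the equalities tested in the case distinction. *)
Lemma base_change_coords_add P Q :
  base_change_coords f (add_coords E P Q) =
  add_coords E' (base_change_coords f P) (base_change_coords f Q).
Proof.
have tangent l x1 y1 x2 : base_change_coords f (Some (chord_tangent E l x1 y1 x2))
    = Some (chord_tangent E' (f l) (f x1) (f y1) (f x2)).
  by rewrite /chord_tangent /= -f1 -f2 -f3
    !(rmorphXn, rmorphB, rmorphD, rmorphM, rmorphN).
case: P => [[x1 y1]|//]; case: Q => [[x2 y2]|//] /=.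
rewrite (inj_eq (fmorph_inj f)) -f1 -f3 -!(rmorphM, rmorphD) fmorph_eq0.
case: eqP => _; last by rewrite tangent fmorph_div !rmorphB.
case: eqP => _ //; rewrite tangent fmorph_div -f2 -f4.
by rewrite !(rmorph_nat, rmorphXn, rmorphB, rmorphD, rmorphM).
Qed.

Lemma ec_mul_coords n (P : ec_point E) (P' : ec_point E') :
  ec_coords P' = base_change_coords f (ec_coords P) ->
  ec_coords (ec_mul n P') = base_change_coords f (ec_coords (ec_mul n P)).
Proof.
move=> DP'; elim: n => //= n IHn.
by rewrite base_change_coords_add -DP' -IHn.
Qed.

Lemma ec_torsion_coords n (P : ec_point E) (P' : ec_point E') :
  ec_coords P' = base_change_coords f (ec_coords P) ->
  ec_torsion n P' <-> ec_torsion n P.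
Proof.
move=> DP'; rewrite /ec_torsion /=; split=> nP; apply: val_inj => /=.
  apply: base_change_coords_inj.
  by rewrite -(ec_mul_coords n DP') nP.
by rewrite (ec_mul_coords n DP') nP.
Qed.

End CoordinateMap.

(** Applying [nu] to the coordinates gives a torsion point of the same curve, as the coefficients
    come from [F]. *)
Lemma torsion_coords_stable (F : fieldExtType rat) (iota : {rmorphism F -> algC})
    (E : ell_curve F) (n : nat) (nu : {rmorphism algC -> algC}) :
  (forall a, nu (iota a) = iota a) ->
  forall z, torsion_coords iota E n z -> torsion_coords iota E n (nu z).
Proof.
move=> nuF z [P [x [y [nP DP Dz]]]].
have nuP : on_curve (base_change iota E) (base_change_coords nu (ec_coords P)).
  rewrite (@base_change_coords_on_curve _ _ nu (base_change iota E)) ?ec_pointP //;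
    exact: nuF.
exists (EcPoint nuP), (nu x), (nu y); split; last by case: Dz => ->; [left | right].
  exact (iffRL (@ec_torsion_coords _ _ nu (base_change iota E) (base_change iota E)
    (nuF _) (nuF _) (nuF _) (nuF _) n P (EcPoint nuP) erefl) nP).
by rewrite /= DP.
Qed.

Lemma torsion_field_normal (F : fieldExtType rat) (iota : {rmorphism F -> algC})
    (E : ell_curve F) (n : nat) :
  normal_over iota (torsion_field iota E n).
Proof. exact: generated_subfield_normal (@torsion_coords_stable _ _ E n). Qed.

Lemma torsion_coords_extension (F : fieldExtType rat) (L : fieldExtType F)
    (iotaL : {rmorphism L -> algC}) (E : ell_curve F) (n : nat)
    (P : ec_point (base_change (in_alg L) E)) (x y : L) :
  ec_torsion n P -> ec_coords P = Some (x, y) ->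
  torsion_coords (iotaL \o in_alg L) E n (iotaL x) /\
  torsion_coords (iotaL \o in_alg L) E n (iotaL y).
Proof.
move=> nP DP; pose E' := base_change (iotaL \o in_alg L) E.
have cP : on_curve E' (base_change_coords iotaL (ec_coords P)).
  rewrite (@base_change_coords_on_curve _ _ iotaL (base_change (in_alg L) E)) //.
  exact: ec_pointP.
have nP' : ec_torsion n (EcPoint cP).
  exact (iffRL (@ec_torsion_coords _ _ iotaL (base_change (in_alg L) E) E'
    erefl erefl erefl erefl n P (EcPoint cP) erefl) nP).
have DP' : ec_coords (EcPoint cP) = Some (iotaL x, iotaL y) by rewrite /= DP.
by split; exists (EcPoint cP), (iotaL x), (iotaL y); split=> //; [left | right].
Qed.

(** * Descent of torsion points from [L] to [F] *)

Theorem theorem4p3 (F : fieldExtType rat) (L : fieldExtType F)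
    (iotaL : {rmorphism L -> algC}) (E : ell_curve F) (p : nat) :
  let iotaF : {rmorphism F -> algC} := iotaL \o in_alg L in
  prime p ->
  (~ exists M : {subfield L},
       [/\ (1 <= M)%VS, (M <= {:L})%VS,
           M <> 1%VS :> {vspace L} & M <> {:L}%VS :> {vspace L}]) ->
  ~ isomorphic_to_quotient
      (subfield_gal (range iotaF) (normal_closure iotaF (range iotaL)))
      (subfield_gal (range iotaF) (torsion_field iotaF E p)) ->
  @ec_torsion L (base_change (in_alg L) E) p =
    base_change_point (in_alg L) (E := E) @` @ec_torsion F E p.
Proof.
move=> iotaF _ noM not_quo; set T := torsion_field iotaF E p in not_quo.
have torsionE (P : ec_point E) :
    ec_torsion p (base_change_point (in_alg L) P) <-> ec_torsion p P.
  exact: (@ec_torsion_coords _ _ (in_alg L) E (base_change (in_alg L) E)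
    erefl erefl erefl erefl).
apply/seteqP; split=> [P nP | _ [P nP <-]]; last exact/torsionE.
have nT := torsion_field_normal iotaF E p.
have [TF _] := nT.
have not_LT : ~ (forall z : L, iotaL z \in T).
  move=> LT; apply: not_quo.
  (* A basis of [L] over [F] serves as the finite generating family of [L]. *)
  have [|S SF sS _ [z _ <-]|a Na genN] := @normal_closure_primitive _ iotaF
    (range iotaL) (map iotaL (vbasis {:L})).
  - by move=> _ /mapP[b _ ->]; exists b.
  - rewrite (coord_vbasis (memvf z)) rmorph_sum rpred_sum // => i _.
    rewrite -mulr_algl rmorphM rpredM //; first exact: SF.
    by apply/sS/map_f/mem_nth; rewrite size_tuple.
  apply: normal_isomorphic_to_quotient Na genN => //.
    exact: normal_closure_normal.
  by move=> z /asboolP/(_ T); apply; split=> // _ [w _ <-].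
(* If [z] were outside [F], then [F(z) = L] since there are no intermediate fields, and every
   element of [L], being a polynomial in [z] over [F], would land in [T]. *)
have in_base z : iotaL z \in T -> z \in 1%VS.
  move=> Tz; apply/negPn/negP => not_z; apply: not_LT => w.
  have : w \in <<1; z>>%VS.
    have [->|neq] := EM (<<1; z>>%AS = {:L}%VS :> {vspace L}).
      exact: memvf.
    case: noM; exists <<1; z>>%AS; split; rewrite ?sub1v ?subvf //.
    by move=> z1; case/negP: not_z; rewrite -z1 memv_adjoin.
  case/Fadjoin_polyP=> q /polyOverP q1 ->.
  rewrite -horner_map rpred_horner //; apply/polyOverP=> i; rewrite coef_map.
  by have /vlineP[a ->] := q1 i; apply: TF.
have TP z : torsion_coords iotaF E p z -> z \in T.
  exact: generated_subfield_mem.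
case DP : (ec_coords P) => [[x y]|]; last first.
  exists (ec_zero E); last exact: val_inj.
  by apply/torsionE; rewrite (_ : base_change_point _ _ = P) //; apply: val_inj.
have [/TP/in_base/vlineP[a Dx] /TP/in_base/vlineP[b Dy]] :=
  torsion_coords_extension iotaL nP DP.
(* Both coordinates of [P] lie in [F], and the curve equation descends along the injective
   [in_alg L]. *)
have cQ : on_curve E (Some (a, b)).
  rewrite -(@base_change_coords_on_curve _ _ (in_alg L) E
    (base_change (in_alg L) E)) //.
  by have := ec_pointP P; rewrite DP Dx Dy.
have DQ : base_change_point (in_alg L) (EcPoint cQ) = P.
  by apply: val_inj; rewrite /= DP Dx Dy.
by exists (EcPoint cQ) => //; apply/torsionE; rewrite DQ.
Qed.
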